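(* Let $\nu>-\frac{1}{2}$. Then, for all $x\geq 0$, $$\frac{I_{\nu+1}(x)}{x^{\nu}}\int_x^{\infty}t^{\nu}K_{\nu}(t)\,dt<\frac{1}{2(\nu+1)},$$ and $$\frac{I_{\nu}(x)}{x^{\nu}}\int_x^{\infty}t^{\nu}K_{\nu}(t)\,dt\leq\frac{\sqrt{\pi}\,\Gamma(\nu+\frac{1}{2})}{2\,\Gamma(\nu+1)},$$ where equality holds in the second inequality in the limit $x\downarrow 0$, i.e. the left-hand side of the second inequality tends to its right-hand side as $x\downarrow 0$.
   Context: Here $\nu$ is real, $I_\nu$ and $K_\nu$ denote the modified Bessel functions of the first and second kind, respectively, of order $\nu$, and $\Gamma$ is the gamma function. At $x=0$ the expressions are understood as their limits as $x\downarrow 0$. *)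

(* Defs.v *)
From HB Require Import structures.
From mathcomp Require Import all_boot all_order all_algebra.
From mathcomp Require Import all_classical all_reals all_analysis.
Import Order.TTheory GRing.Theory Num.Theory.
Import numFieldNormedType.Exports.

Set Implicit Arguments.
Unset Strict Implicit.
Unset Printing Implicit Defensive.

Local Open Scope classical_set_scope.
Local Open Scope ring_scope.

(* Euler's integral: this is the gamma function only for 0 < s (for s <= 0 the
   integral diverges and the value is 0, not the analytic continuation). *)
Definition Gamma (R : realType) (s : R) : R :=
  Rintegral (@lebesgue_measure R) `]0, +oo[ (fun t => t `^ (s - 1) * expR (- t)).

(* I_nu(x) = \sum_k (x / 2)^(nu + 2k) / (k! Gamma(nu + k + 1)).
   Intended for 0 < x, and for -1 < nu so that Gamma is only evaluated at
   positive arguments. *)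
Definition besselI (R : realType) (nu x : R) : R :=
  limn (series (fun k : nat =>
    (x / 2) `^ (nu + k.*2%:R) / (k`!%:R * Gamma (nu + k%:R + 1)))).

Definition cosh (R : realType) (t : R) : R := (expR t + expR (- t)) / 2.

(* K_nu(x) = \int_0^oo exp(- x cosh t) cosh(nu t) dt, for 0 < x and all real nu. *)
Definition besselK (R : realType) (nu x : R) : R :=
  Rintegral (@lebesgue_measure R) `[0, +oo[
    (fun t => expR (- (x * cosh t)) * cosh (nu * t)).

(* Extended-real valued, so that an upper bound by a real number on an
   expression containing it also asserts that the integral is finite. *)
Definition tailK (R : realType) (nu x : R) : \bar R :=
  (\int[@lebesgue_measure R]_(t in `[x, +oo[) (t `^ nu * besselK nu t)%:E)%E.

(* (I_mu(x) / x^nu) \int_x^oo t^nu K_nu(t) dt, for 0 < x. *)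
Definition IK (R : realType) (mu nu x : R) : \bar R :=
  ((besselI mu x / x `^ nu)%:E * tailK nu x)%E.

(* f with its value at 0 replaced by its limit from the right at 0. *)
Definition ext0 (R : realType) (f : R -> \bar R) (x : R) : \bar R :=
  if x == 0 then lim (f y @[y --> 0^'+]) else f x.

(* Main.v *)
(* With z = x^2 / 4, the functions
     besselG nu z = (x / 2)^-nu I_nu(x)  and  besselH nu z = 2 (x / 2)^nu K_nu(x)
   satisfy G_nu' = G_(nu+1) and H_nu' = - H_(nu-1).  Put
   tau(x) = \int_x^oo H_nu(t^2 / 4) dt.
   - As t / x >= 1 on [x, +oo[ and t H_nu(t^2 / 4) is an exact derivative,
     tau(x) <= (2 / x) H_(nu+1)(z); so the first expression is at most
     G_(nu+1) H_(nu+1) / 2 = I_(nu+1) K_(nu+1), and mu G_mu H_mu < 1 follows from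
     the Wronskian G_mu H_(mu+1) + z G_(mu+1) H_mu <= 1.
   - The second expression is G_nu tau / 2.  By the same bound on tau its
     derivative is nonpositive as soon as
     I_(nu+1) K_(nu+1) <= I_nu K_nu, which holds because I_(nu+1) / I_nu and
     K_nu / K_(nu+1) are separated by the positive root of
     r^2 + (2 nu + 1) r / x = 1.  Hence it is bounded by its limit at 0, where
     tau(0) is computed by Tonelli and the Gaussian integral. *)

Require Import Defs.
From HB Require Import structures.
From mathcomp Require Import all_boot all_order all_algebra.
From mathcomp Require Import all_classical all_reals all_analysis.
From mathcomp Require Import measurable_realfun ring lra.
Import Order.TTheory GRing.Theory Num.Theory.
Import numFieldNormedType.Exports.

Local Open Scope classical_set_scope.
Local Open Scope ring_scope.

Set Implicit Arguments.
Unset Strict Implicit.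
Unset Printing Implicit Defensive.

(** * Continuity from derivatives and an integrable exponential envelope *)

Lemma is_derive_continuous (R : realType) (f : R -> R) (x df : R) :
  is_derive x 1 f df -> {for x, continuous f}.
Proof.
by move=> fx; apply/differentiable_continuous/derivable1_diffP; exact: ex_derive.
Qed.

Lemma cvgy_expRN (R : realType) (e : R) : 0 < e ->
  expR (- (e * x)) @[x --> +oo] --> 0.
Proof.
move=> e0.
apply: (cvg_comp (fun x => e * x) (fun y => expR (- y))); last exact: cvgr_expR.
exact: gt0_cvgMry.
Qed.

(** Up to a constant, this is the function that dominates every convergent [phi p z]; by symmetry
    its integral reduces to that of a pure exponential on the half-line. *)
Lemma integrable_expRN_abs (R : realType) (e : R) : 0 < e ->
  (@lebesgue_measure R).-integrable setT (EFin \o (fun u => expR (- (e * `|u|)))).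
Proof.
move=> e0.
have cf : continuous (fun u : R => expR (- (e * `|u|))).
  move=> u; apply: continuous_comp; last exact: continuous_expR.
  apply: continuousN; apply: continuousM; first exact: cst_continuous.
  exact: norm_continuous.
apply/integrableP; split.
  apply/measurable_EFinP; exact: continuous_measurable_fun.
under eq_integral do rewrite /= ger0_norm ?expR_ge0//.
rewrite ge0_symfun_integralT//; last by move=> x /=; rewrite normrN.
rewrite -set_itvcy.
under eq_integral.
  move=> x; rewrite inE/= in_itv/= andbT => x0; rewrite ger0_norm//; over.
have D x : is_derive x (1:R) (fun x => - e^-1 * expR (- (e * x))) (expR (- (e * x))).
  apply: is_derive_eq; rewrite /GRing.scale /=; field; lra.
rewrite (@ge0_continuous_FTC2y _ _ (fun x => - e^-1 * expR (- (e * x))) 0 0).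
- by rewrite -EFinB -EFinM ltry.
- by move=> x _; exact: expR_ge0.
- by apply: continuous_subspaceT => u; exact: is_derive_continuous.
- rewrite -[X in _ --> X](mulr0 (- e^-1)); apply: cvgM; first exact: cvg_cst.
  exact: cvgy_expRN.
- by move=> x _; exact: ex_derive.
- by apply: cvg_at_right_filter; exact: is_derive_continuous (D 0).
- by move=> x _; rewrite derive1E derive_val.
Qed.

(** * The integral [besselH]: convergence, positivity, bounds *)

(* The substitution [s = expR u] turns [exp (- s - z / s) s^(p - 1) ds] on ]0, +oo[
   into [phi p z u du] on the whole line. *)
Definition phi (R : realType) (p z u : R) : R :=
  expR (p * u - expR u - z * expR (- u)).

Definition besselH (R : realType) (p z : R) : R :=
  Rintegral (@lebesgue_measure R) setT (phi p z).

(** The left-hand side is the tangent line of the exponential at [ln m], hence of prescribed slope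
    [m]. *)
Lemma expR_ge_affine (R : realType) (m u : R) : 0 < m ->
  m * (u + 1 - ln m) <= expR u.
Proof.
move=> m0; have := expR_ge1Dx (u - ln m).
rewrite expRD expRN lnK ?posrE// ler_pdivlMr// => h; lra.
Qed.

(** As [u] grows, [expR u] beats the linear term [p * u]. As [u] tends to minus infinity, the decay
    comes from [p * u] itself if [0 < p], and from [z * expR (- u)] if [0 < z]. *)
Lemma phi_le_exp (R : realType) (p z : R) : 0 <= z -> 0 < p \/ 0 < z ->
  exists C e : R, 0 < e /\ forall u, phi p z u <= expR C * expR (- (e * `|u|)).
Proof.
move=> z0 [p0|{}z0].
  (* A tangent of slope [2 * p] under [expR u] turns [p * u] into [- p * u], whence the rate [p]. *)
  exists `|2 * p * (1 - ln (2 * p))|, p; split => // u.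
  rewrite -expRD ler_expR.
  have ez : 0 <= z * expR (- u) by rewrite mulr_ge0// expR_ge0.
  have [u0|u0] := leP 0 u.
    have p2 : 0 < 2 * p by lra.
    have := expR_ge_affine u p2.
    have := ler_norm (- (2 * p * (1 - ln (2 * p)))).
    rewrite normrN (ger0_norm u0); lra.
  rewrite (ltr0_norm u0); have := expR_gt0 u.
  have := normr_ge0 (2 * p * (1 - ln (2 * p))); lra.
have m0 : 0 < `|p| + 1 by have := normr_ge0 p; lra.
have mz0 : 0 < (`|p| + 1) / z by rewrite divr_gt0.
(* Tangents of total slope [|p| + 1] on both sides outweigh [p * u] by exactly [|u|], whence the
   rate 1; the division by [z] compensates the factor in [z * expR (- u)]. *)
exists (`|(`|p| + 1) * (1 - ln (`|p| + 1))| + `|(`|p| + 1) * (1 - ln ((`|p| + 1) / z))|).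
exists 1; split => // u; rewrite -expRD ler_expR.
have n1 := normr_ge0 ((`|p| + 1) * (1 - ln (`|p| + 1))).
have n2 := normr_ge0 ((`|p| + 1) * (1 - ln ((`|p| + 1) / z))).
have pp := ler_norm p.
have pN := ler_norm (- p); rewrite normrN in pN.
have [u0|u0] := leP 0 u.
  have ez : 0 <= z * expR (- u) by rewrite mulr_ge0 ?expR_ge0// ltW.
  have := expR_ge_affine u m0.
  have := ler_norm (- ((`|p| + 1) * (1 - ln (`|p| + 1)))).
  rewrite normrN (ger0_norm u0); nra.
rewrite (ltr0_norm u0); have := expR_gt0 u.
have := expR_ge_affine (- u) mz0.
rewrite -(ler_pM2l z0) mulrA mulrCA divff ?gt_eqF// mulr1.
have := ler_norm (- ((`|p| + 1) * (1 - ln ((`|p| + 1) / z)))).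
rewrite normrN; nra.
Qed.

Lemma continuous_phi (R : realType) (p z : R) : continuous (phi p z).
Proof. by move=> u; exact: is_derive_continuous. Qed.

Lemma phi_gt0 (R : realType) (p z u : R) : 0 < phi p z u.
Proof. exact: expR_gt0. Qed.

Lemma measurable_phi (R : realType) (p z : R) (D : set R) :
  measurable_fun D (EFin \o phi p z).
Proof.
have mphi : measurable_fun setT (phi p z).
  exact: (continuous_measurable_fun (@continuous_phi R p z)).
exact/measurable_EFinP/measurable_funTS.
Qed.

Lemma integrable_phi (R : realType) (p z : R) : 0 <= z -> 0 < p \/ 0 < z ->
  (@lebesgue_measure R).-integrable setT (EFin \o phi p z).
Proof.
move=> z0 pz; have [C [e [e0 phiC]]] := phi_le_exp z0 pz.
have := @integrableZl _ _ _ (@lebesgue_measure R) setT measurableT (expR C) _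
  (integrable_expRN_abs e0).
apply: le_integrable => //; first exact: measurable_phi.
move=> u _ /=; rewrite lee_fin [leLHS]ger0_norm ?expR_ge0// [leRHS]ger0_norm//.
Qed.

Lemma EFin_besselH (R : realType) (p z : R) : 0 <= z -> 0 < p \/ 0 < z ->
  (besselH p z)%:E = (\int[@lebesgue_measure R]_u (phi p z u)%:E)%E.
Proof.
move=> z0 pz; rewrite /besselH /Rintegral fineK//.
exact: (integrable_fin_num _ (integrable_phi z0 pz)).
Qed.

Lemma besselH_gt0 (R : realType) (p z : R) : 0 <= z -> 0 < p \/ 0 < z ->
  0 < besselH p z.
Proof.
move=> z0 pz; rewrite -lte_fin EFin_besselH//.
(* A lower bound of the integrand on [[0, 1]], where [p * u >= - |p|], [expR u <= expR 1] and
   [expR (- u) <= 1]. *)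
set c := expR (- `|p| - expR 1 - z).
have c0 : 0 < c by exact: expR_gt0.
apply: (@lt_le_trans _ _
  (\int[@lebesgue_measure R]_(u in `[0%R, 1%R]) (phi p z u)%:E)%E); last first.
  apply: ge0_subset_integral => //.
  - exact: measurable_phi.
  - by move=> u _; rewrite lee_fin ltW ?phi_gt0.
apply: (@lt_le_trans _ _ (\int[@lebesgue_measure R]_(u in `[0%R, 1%R]) c%:E)%E).
  by rewrite integral_cst//= lebesgue_measure_itv/= lte_fin ltr01 sube0 mule1 lte_fin.
apply: ge0_le_integral => //.
- by move=> u _; rewrite lee_fin ltW.
- exact: measurable_phi.
- move=> u /=; rewrite in_itv/= => /andP[u0 u1]; rewrite lee_fin ler_expR.
  have : z * expR (- u) <= z by rewrite ler_piMr// -expR0 ler_expR; lra.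
  have : expR u <= expR 1 by rewrite ler_expR.
  have := ler_norm (- p); rewrite normrN; have := normr_ge0 p; nra.
Qed.

Lemma besselH_le0 (R : realType) (p z : R) : 0 <= z -> 0 < p ->
  besselH p z <= besselH p 0.
Proof.
move=> z0 p0; rewrite -lee_fin !EFin_besselH//; try by left.
apply: ge0_le_integral => //.
- by move=> u _; rewrite lee_fin ltW ?phi_gt0.
- exact: measurable_phi.
- exact: measurable_phi.
- move=> u _; rewrite lee_fin ler_expR mul0r subr0 gerBl.
  by rewrite mulr_ge0// expR_ge0.
Qed.

(** * Derivative and recurrence of [besselH] *)

Lemma phiM_expR (R : realType) (p q z u : R) :
  expR (q * u) * phi p z u = phi (p + q) z u.
Proof. by rewrite /phi -expRD; congr expR; ring. Qed.

(** Differentiation under the integral sign. Since [phi] decreases in [z], its value at [z / 2]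
    dominates the derivative of the integrand uniformly on a neighbourhood of [z]. *)
Lemma is_derive_besselH (R : realType) (p z : R) : 0 < z ->
  is_derive z 1 (besselH p) (- besselH (p - 1) z).
Proof.
move=> z0.
have dphi (x u : R) : is_derive x 1 (fun x => phi p x u) (- phi (p - 1) x u).
  rewrite -phiM_expR mulN1r.
  apply: is_derive_eq; rewrite /GRing.scale /= /phi; ring.
have Iz : `](z / 2), (z + 1)[%classic z by rewrite /= in_itv/=; apply/andP; split; lra.
have Ipos (x : R) : `](z / 2), (z + 1)[%classic x -> 0 < x /\ z / 2 <= x.
  by rewrite /= in_itv/= => /andP[? ?]; split; lra.
have z20 : 0 < z / 2 by lra.
have intf (x : R) : `](z / 2), (z + 1)[%classic x ->
    (@lebesgue_measure R).-integrable setT (EFin \o phi p x).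
  by move=> /Ipos[x0 _]; apply: integrable_phi; [exact: ltW|right].
have derf (x y : R) : `](z / 2), (z + 1)[%classic x -> setT y ->
  derivable (fun x => phi p x y) x 1.
  by move=> _ _; exact: ex_derive.
have intG : (@lebesgue_measure R).-integrable setT (EFin \o phi (p - 1) (z / 2)).
  by apply: integrable_phi; [exact: ltW|right].
have d1E (x y : R) : partial1of2 (phi p) x y = - phi (p - 1) x y.
  by rewrite partial1of2E derive_val.
have G_ub (x y : R) : `](z / 2), (z + 1)[%classic x -> setT y ->
  `|partial1of2 (phi p) x y| <= phi (p - 1) (z / 2) y.
  move=> /Ipos[x0 zx] _; rewrite d1E normrN ger0_norm ?expR_ge0//.
  by rewrite ler_expR lerD2l lerN2 ler_wpM2r ?expR_ge0.
have D := derivable_under_integral measurableT Iz intf derf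
  (fun y => expR_ge0 _) intG G_ub.
have E := differentiation_under_integral measurableT Iz intf derf
  (fun y => expR_ge0 _) intG G_ub.
apply: DeriveDef => //.
rewrite -derive1E E /besselH.
under eq_Rintegral do rewrite d1E -[- phi _ _ _]mulN1r.
rewrite RintegralZl ?mulN1r//.
by apply: integrable_phi; [exact: ltW|right].
Qed.

(** Dominated convergence along the intervals [[-n, n]], on each of which the fundamental theorem
    applies; limits of [F] along the integers therefore suffice. *)
Lemma integral_derive_eq0 (R : realType) (F f : R -> R) :
  (forall x : R, is_derive x 1 F (f x)) -> continuous f ->
  (@lebesgue_measure R).-integrable setT (EFin \o f) ->
  F n%:R @[n --> \oo] --> 0 -> F (- n%:R) @[n --> \oo] --> 0 ->
  Rintegral (@lebesgue_measure R) setT f = 0.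
Proof.
move=> dF cf intf Fy FNy.
have mf : measurable_fun setT (EFin \o f) by exact: measurable_int intf.
pose S (n : nat) : set R := `[(- n%:R), n%:R]%classic.
have fS : {ae @lebesgue_measure R, forall x, setT x ->
    ((EFin \o f) \_ (S n)) x @[n --> \oo] --> (EFin \o f) x}.
  apply: aeW => x _; apply: cvg_near_cst; near=> n.
  have : `|x| <= n%:R by near: n; exact: nbhs_infty_ger.
  by rewrite ler_norml patchE => xn; rewrite mem_set// /S/= in_itv.
have mS n : measurable_fun setT ((EFin \o f) \_ (S n)).
  apply/(measurable_restrict _ _ _) => //; first exact: measurable_itv.
  exact: measurable_funS mf.
have domS : {ae @lebesgue_measure R, forall x n, setT x ->
    (`|((EFin \o f) \_ (S n)) x| <= (abse \o (EFin \o f)) x)%E}.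
  by apply: aeW => x n _; rewrite patchE; case: ifP => //= _; rewrite normr0 lee_fin.
have [_ _ /=] := @dominated_convergence _ _ _ (@lebesgue_measure R) setT
  measurableT _ _ _ mS mf fS (integrable_abse intf) domS.
rewrite /Rintegral => fI.
suff -> : (\int[@lebesgue_measure R]_x (f x)%:E = 0)%E by [].
apply: (cvg_unique _ fI) => //.
have E n : (0 < n)%N ->
    (\int[@lebesgue_measure R]_x ((EFin \o f) \_ (S n)) x)%E = (F n%:R - F (- n%:R))%:E.
  move=> n0; rewrite -integral_mkcond EFinB; apply: continuous_FTC2.
  - by rewrite -subr_gt0 opprK addr_gt0// ltr0n.
  - exact: continuous_subspaceT.
  - split.
    + by move=> x _; exact: ex_derive.
    + by apply: cvg_at_right_filter; exact: is_derive_continuous (dF _).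
    + by apply: cvg_at_left_filter; exact: is_derive_continuous (dF _).
  - by move=> x _; rewrite derive1E derive_val.
have : (F n%:R - F (- n%:R))%:E @[n --> \oo] --> (0 - 0 : R)%:E.
  by apply: cvg_EFin; [exact: nearW|exact: cvgB].
rewrite subr0; apply: cvg_trans; apply: near_eq_cvg; near=> n; rewrite E//.
by near: n; exact: nbhs_infty_gt.
Unshelve. all: by end_near. Qed.
Lemma phi_cvg0 (R : realType) (p z : R) : 0 <= z -> 0 < p \/ 0 < z ->
  phi p z n%:R @[n --> \oo] --> 0 /\ phi p z (- n%:R) @[n --> \oo] --> 0.
Proof.
move=> z0 pz; have [C [e [e0 phiC]]] := phi_le_exp z0 pz.
have lim0 : expR C * expR (- (e * n%:R)) @[n --> \oo] --> (0 : R).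
  rewrite -[X in _ --> X](mulr0 (expR C)); apply: cvgM; first exact: cvg_cst.
  exact: (cvg_comp (fun n => n%:R) _ cvgr_idn (cvgy_expRN e0)).
split; apply: squeeze_cvgr (cvg_cst 0) lim0; apply: nearW => n.
  by rewrite ltW ?phi_gt0//= (le_trans (phiC _))// ger0_norm.
by rewrite ltW ?phi_gt0//= (le_trans (phiC _))// normrN ger0_norm.
Qed.

Lemma integrableZ_phi (R : realType) (c p z : R) : 0 <= z -> 0 < p \/ 0 < z ->
  (@lebesgue_measure R).-integrable setT (EFin \o (fun u => c * phi p z u)).
Proof.
by move=> z0 pz; exact: (integrableZl measurableT c (integrable_phi z0 pz)).
Qed.

(** The derivative of [phi p z] in [u] is [(p - expR u + z * expR (- u)) * phi p z u], and its
    integral over the line vanishes. *)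
Lemma besselH_rec (R : realType) (p z : R) : 0 <= z -> 0 < p \/ 0 < z ->
  besselH (p + 1) z = z * besselH (p - 1) z + p * besselH p z.
Proof.
move=> z0 pz; have [phiy phiNy] := phi_cvg0 z0 pz.
pose f u := z * phi (p - 1) z u + p * phi p z u - phi (p + 1) z u.
have i1 : (@lebesgue_measure R).-integrable setT (EFin \o (fun u => z * phi (p - 1) z u)).
  (* At [z = 0] the function [phi (p - 1) 0] is not integrable for [p <= 1], but its product with
     [z] is identically zero. *)
  move: z0; rewrite le_eqVlt => /predU1P[z0|z0]; last first.
    by apply: integrableZ_phi; [exact: ltW|right].
  have -> : (fun u => z * phi (p - 1) z u) = cst 0.
    by apply/funext => u; rewrite -z0 mul0r.
  exact: integrable0.
have i2 : (@lebesgue_measure R).-integrable setT (EFin \o (fun u => p * phi p z u)).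
  exact: integrableZ_phi.
have i3 : (@lebesgue_measure R).-integrable setT (EFin \o phi (p + 1) z).
  apply: integrable_phi => //; case: pz => [p0|]; [left; lra|by right].
have i12 := integrableD measurableT i1 i2.
have df (x : R) : is_derive x 1 (phi p z) (f x).
  rewrite /f -!phiM_expR mulN1r mul1r.
  by apply: is_derive_eq; rewrite /GRing.scale /= /phi; ring.
have cf : continuous f by move=> u; exact: is_derive_continuous.
have intf := integrableB measurableT i12 i3.
have := integral_derive_eq0 df cf intf phiy phiNy.
rewrite RintegralB// RintegralD//.
rewrite [X in _ + X - _]RintegralZl//; last exact: integrable_phi.
rewrite -!/(besselH _ _).
have -> : Rintegral (@lebesgue_measure R) setT (fun u => z * phi (p - 1) z u)
    = z * besselH (p - 1) z.
  move: z0; rewrite le_eqVlt => /predU1P[<-|z0].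
    by under eq_Rintegral do rewrite mul0r; rewrite Rintegral_cst// mul0r mul0r.
  by rewrite RintegralZl//; apply: integrable_phi; [exact: ltW|right].
by move/eqP; rewrite subr_eq0 => /eqP <-.
Qed.

(** Provides decay at infinity: the recurrence at [p + 1] has only nonnegative terms, one of them
    [z * besselH p z], and [besselH (p + 2)] is largest at 0. *)
Lemma besselH_le (R : realType) (p z : R) : -1 < p -> 0 < z ->
  besselH p z <= besselH (p + 2) 0 / z.
Proof.
move=> p1 z0; rewrite ler_pdivlMr//.
have p2 : p + 2 = p + 1 + 1 by ring.
have p20 : 0 < p + 2 by lra.
apply: le_trans (besselH_le0 (ltW z0) p20).
rewrite p2 besselH_rec ?(ltW z0)//; last by right.
have -> : p + 1 - 1 = p by ring.
rewrite mulrC lerDl mulr_ge0//; first by lra.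
by rewrite ltW// besselH_gt0 ?(ltW z0)//; right.
Qed.

(** * The gamma function as [besselH] at 0 *)

(** The substitution [t = expR u] is carried out on the compact intervals [[-n, n]], whose images
    stay away from 0, where [t] to the power [p - 1] may be singular. Both integrals are then
    monotone limits. *)
Lemma Gamma_besselH (R : realType) (p : R) : Gamma p = besselH p 0.
Proof.
rewrite /Gamma /besselH /Rintegral; congr fine.
pose G (t : R) := t `^ (p - 1) * expR (- t).
pose S (n : nat) : set R := `[(- n%:R), n%:R]%classic.
pose ES (n : nat) : set R := `[expR (- n%:R), expR n%:R]%classic.
have cG (t : R) : 0 < t -> {for t, continuous G}.
  move=> t0; apply: continuousM.
    exact: is_derive_continuous (is_derive1_powR _ t0).
  exact: is_derive_continuous.
have US : \bigcup_n S n = setT.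
  apply/seteqP; split => // x _.
  have [n xn] : exists n : nat, `|x| <= n%:R.
    by exists (Num.truncn `|x|).+1; exact/ltW/truncnS_gt.
  by exists n => //; rewrite /S/= in_itv/= -ler_norml.
have UES : \bigcup_n ES n = `]0, +oo[%classic.
  apply/seteqP; split => x.
    move=> [n _]; rewrite /ES/= !in_itv/= andbT => /andP[+ _].
    by apply: lt_le_trans; exact: expR_gt0.
  rewrite /= in_itv/= andbT => x0.
  have : (\bigcup_n S n) (ln x) by rewrite US.
  move=> [n _]; rewrite /S/= in_itv/= => /andP[h1 h2]; exists n => //.
  by rewrite /ES/= in_itv/= -(lnK x0) !ler_expR h1 h2.
have mES n : measurable (ES n) by exact: measurable_itv.
have mS n : measurable (S n) by exact: measurable_itv.
have G0 n x : ES n x -> (0 <= (G x)%:E)%E.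
  by move=> _; rewrite lee_fin mulr_ge0 ?powR_ge0 ?expR_ge0.
have ndES : nondecreasing_seq ES.
  move=> m n mn; rewrite subsetEset; apply: subset_itv; rewrite bnd_simp ler_expR ?lerN2 ler_nat//.
have ndS : nondecreasing_seq S.
  by move=> m n mn; rewrite subsetEset; apply: subset_itv; rewrite bnd_simp ?lerN2 ler_nat.
have mG n : measurable_fun (ES n) (EFin \o G).
  have mG0 : measurable_fun (`]0, +oo[%classic : set R) G.
    apply: open_continuous_measurable_fun; first exact: interval_open.
    by move=> x; rewrite inE/= in_itv/= andbT; exact: cG.
  apply/measurable_EFinP; apply: measurable_funS mG0 => //.
  by rewrite -UES; exact: bigcup_sup.
have c1 : (\int[@lebesgue_measure R]_(x in ES i) (EFin \o G) x)%E @[i --> \oo] -->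
    (\int[@lebesgue_measure R]_(x in \bigcup_i ES i) (EFin \o G) x)%E.
  exact: ge0_nondecreasing_set_cvg_integral.
have p0 n x : S n x -> (0 <= (EFin \o phi p 0) x)%E.
  by move=> _; rewrite lee_fin ltW ?phi_gt0.
have c2 : (\int[@lebesgue_measure R]_(x in S i) (EFin \o phi p 0) x)%E @[i --> \oo] -->
    (\int[@lebesgue_measure R]_(x in \bigcup_i S i) (EFin \o phi p 0) x)%E.
  by apply: ge0_nondecreasing_set_cvg_integral => // n; exact: measurable_phi.
rewrite UES in c1; rewrite US in c2.
apply: (cvg_unique _ c1) => //.
apply: cvg_trans c2; apply: near_eq_cvg; apply: nearW => n.
have dE : (@expR R)^`()%classic = @expR R by apply/funext => x; rewrite derive1E derive_val.
rewrite /ES (@integration_by_substitution_increasing _ (@expR R) G); first last.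
- apply: continuous_in_subspaceT => x; rewrite inE/= in_itv/= => /andP[+ _].
  by move=> /(lt_le_trans (expR_gt0 _)); exact: cG.
- split.
  + by move=> x _; exact: ex_derive.
  + by apply: cvg_at_right_filter; exact: continuous_expR.
  + by apply: cvg_at_left_filter; exact: continuous_expR.
- by rewrite dE; apply/cvg_ex; eexists; apply: cvg_at_left_filter; exact: continuous_expR.
- by rewrite dE; apply/cvg_ex; eexists; apply: cvg_at_right_filter; exact: continuous_expR.
- by rewrite dE => x _; exact: continuous_expR.
- by move=> x y _ _; rewrite ltr_expR.
- by rewrite lerNl (le_trans _ (ler0n _ _))// lerNl oppr0.
apply: eq_integral => x _; rewrite dE; congr EFin.
transitivity (G (expR x) * expR x) => //.
by rewrite /G -expRM -!expRD /phi /=; congr expR; ring.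
Qed.

(** * From [besselK] to [besselH] *)

Lemma ge0_integral_affine (R : realType) (G : R -> R) (a b : R) : 0 < a ->
  continuous G -> (forall x, 0 <= G x) ->
  (\int[@lebesgue_measure R]_x (G x)%:E =
   \int[@lebesgue_measure R]_x (G (a * x + b) * a)%:E)%E.
Proof.
move=> a0 cG G0.
have dF (x : R) : is_derive x 1 (fun x => a * x + b) a.
  by apply: is_derive_eq; rewrite /GRing.scale /= mulr1 addr0.
have F'E : (fun x : R => a * x + b)^`()%classic = cst a.
  by apply/funext => x; rewrite derive1E derive_val.
rewrite (@increasing_ge0_integration_by_substitutionT _ (fun x => a * x + b) G)//.
- by apply: eq_integral => x _; rewrite F'E.
- by move=> x y xy; rewrite ltrD2r ltr_pM2l.
- by rewrite F'E; exact: cst_continuous.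
- by rewrite F'E; exact: is_cvg_cst.
- by rewrite F'E; exact: is_cvg_cst.
- apply/cvgrNyPle => M; near=> x.
  rewrite -lerBrDr mulrC -ler_pdivlMr//; near: x; exact: nbhs_ninfty_le.
- apply/cvgryPge => M; near=> x.
  rewrite -lerBlDr mulrC -ler_pdivrMr//; near: x; exact: nbhs_pinfty_ge.
Unshelve. all: by end_near. Qed.

Lemma ge0_integral_fold (R : realType) (f : R -> R) :
  continuous f -> (forall x, 0 <= f x) ->
  (\int[@lebesgue_measure R]_(x in `[0%R, +oo[) (f x + f (- x))%:E =
   \int[@lebesgue_measure R]_x (f x)%:E)%E.
Proof.
move=> cf f0.
have mf : measurable_fun [set: R] f by exact: continuous_measurable_fun.
have cfN : continuous (fun x => f (- x)).
  by move=> x; apply: continuous_comp; [exact: opp_continuous|exact: cf].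
have mfN : measurable_fun [set: R] (fun x => f (- x)).
  exact: (continuous_measurable_fun cfN).
under eq_integral do rewrite EFinD.
rewrite ge0_integralD//; last 4 first.
- by move=> x _; rewrite lee_fin.
- exact/measurable_EFinP/measurable_funTS.
- by move=> x _; rewrite lee_fin.
- exact/measurable_EFinP/measurable_funTS.
have := @ge0_integration_by_substitutionNy R f 0.
rewrite oppr0 => <-//; last exact: continuous_subspaceT.
rewrite -integral_itv_bndo_bndc; last exact/measurable_EFinP/measurable_funTS.
rewrite addeC -ge0_integral_setU//=; last 3 first.
- by rewrite -itv_bndbnd_setU//; exact/measurable_EFinP/measurable_funTS.
- by move=> x _; rewrite lee_fin.
- by apply/disj_setPS => x []; rewrite /= !in_itv/= andbT => /lt_geF ->.
by rewrite -itv_bndbnd_setU// set_itvNyy.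
Qed.

(** Expanding [cosh (nu * t)] writes the integrand as [f t + f (- t)], which unfolds to an integral
    of [f] over the line. The shift [u = t + ln (x / 2)] then turns [x * cosh t] into
    [expR u + (x ^+ 2 / 4) * expR (- u)] and produces the power of [x / 2]. *)
Lemma besselK_besselH (R : realType) (nu x : R) : 0 < x ->
  besselK nu x = 2^-1 * (x / 2) `^ (- nu) * besselH nu (x ^+ 2 / 4).
Proof.
move=> x0; have x20 : 0 < x / 2 by lra.
have z0 : 0 < x ^+ 2 / 4 by rewrite divr_gt0 ?exprn_gt0//; lra.
set c := 2^-1 * (x / 2) `^ (- nu).
have c0 : 0 <= c by rewrite mulr_ge0 ?powR_ge0//; lra.
set l := ln (x / 2).
pose f t := c * phi nu (x ^+ 2 / 4) (1 * t + l).
have cf : continuous f by move=> t; exact: is_derive_continuous.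
have f0 t : 0 <= f t by rewrite mulr_ge0// ltW// phi_gt0.
rewrite /besselK /Rintegral.
have fE t : f t = 2^-1 * expR (nu * t - x * cosh t).
  have el : expR l = x / 2 by rewrite lnK.
  rewrite /f /phi /c -[X in X `^ _]el -expRM -mulrA -expRD; congr (_ * expR _).
  rewrite mul1r opprD !expRD [expR (- l)]expRN el /cosh.
  by field; rewrite gt_eqF.
have ffE t : expR (- (x * cosh t)) * cosh (nu * t) = f t + f (- t).
  have coshN : cosh (- t) = cosh t by rewrite /cosh opprK addrC.
  by rewrite !fE coshN mulrN !expRD /cosh; field.
under eq_integral do rewrite ffE.
rewrite ge0_integral_fold// -[RHS]/(fine _%:E); congr fine.
rewrite EFinM EFin_besselH ?(ltW z0)//; last by right.
rewrite (@ge0_integral_affine _ (phi nu (x ^+ 2 / 4)) 1 l)//; last 2 first.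
- exact: continuous_phi.
- by move=> t; rewrite ltW ?phi_gt0.
rewrite -ge0_integralZl_EFin//; last 2 first.
- by move=> t _; rewrite mulr1 lee_fin ltW ?phi_gt0.
- apply/measurable_EFinP; apply: continuous_measurable_fun => t.
  exact: is_derive_continuous.
by apply: eq_integral => t _; rewrite mulr1 -EFinM.
Qed.

(** * The full tail integral, by Tonelli and the Gaussian integral *)

Lemma integral_gauss_half (R : realType) (a : R) : 0 < a ->
  (\int[@lebesgue_measure R]_(t in `[0%R, +oo[) (gauss_fun (a * t) * a)%:E =
   (Num.sqrt pi / 2)%:E)%E.
Proof.
move=> a0; rewrite -integral0y_gauss.
have dF (x : R) : is_derive x 1 (fun x => a * x) a.
  by apply: is_derive_eq; rewrite /GRing.scale /= mulr1.
have F'E : (fun x : R => a * x)^`()%classic = cst a.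
  by apply/funext => x; rewrite derive1E derive_val.
have -> : `[0%R, +oo[%classic = `[a * 0, +oo[%classic :> set R by rewrite mulr0.
rewrite (@increasing_ge0_integration_by_substitutiony _ (fun x => a * x) gauss_fun 0)//.
- by rewrite mulr0; apply: eq_integral => x _; rewrite F'E.
- by move=> x y _ _ xy; rewrite ltr_pM2l.
- by rewrite F'E => x _; exact: cst_continuous.
- by rewrite F'E; exact: is_cvg_cst.
- by rewrite F'E; exact: is_cvg_cst.
- split; first by move=> x _; exact: ex_derive.
  by apply: cvg_at_right_filter; exact: is_derive_continuous (dF 0).
- exact: gt0_cvgMry.
- by apply: continuous_subspaceT; exact: continuous_gauss_fun.
- by move=> x _; exact: gauss_fun_ge0.
Qed.

Lemma sqr_quarter_gt0 (R : realType) (t : R) : 0 < t -> 0 < t ^+ 2 / 4.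
Proof. by move=> t0; rewrite divr_gt0 ?exprn_gt0//; lra. Qed.

Lemma is_derive_besselH_sqr (R : realType) (p t : R) : 0 < t ->
  is_derive t 1 (fun t => besselH p (t ^+ 2 / 4))
    (- (t / 2) * besselH (p - 1) (t ^+ 2 / 4)).
Proof.
move=> t0; have dH := is_derive_besselH p (sqr_quarter_gt0 t0).
have dq : is_derive t 1 (fun t => t ^+ 2 / 4) (t / 2).
  by apply: is_derive_eq; rewrite /GRing.scale /=; field.
have := @is_derive1_comp R (besselH p) (fun t => t ^+ 2 / 4) t _ _ dH dq.
rewrite /comp => h; apply: is_derive_eq; rewrite /GRing.scale /=; ring.
Qed.

Lemma measurable_besselH_sqr (R : realType) (p : R) :
  measurable_fun (`]0, +oo[%classic : set R) (fun t => besselH p (t ^+ 2 / 4)).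
Proof.
apply: open_continuous_measurable_fun; first exact: interval_open.
move=> x; rewrite inE/= in_itv/= andbT => x0.
exact: is_derive_continuous (is_derive_besselH_sqr p x0).
Qed.

Lemma EFinM_besselH (R : realType) (c p z : R) : 0 <= c -> 0 <= z ->
  0 < p \/ 0 < z ->
  (\int[@lebesgue_measure R]_u (c * phi p z u)%:E = (c * besselH p z)%:E)%E.
Proof.
move=> c0 z0 pz; under eq_integral do rewrite EFinM.
rewrite ge0_integralZl_EFin; last 3 first.
- by move=> u _; rewrite lee_fin; apply/ltW/phi_gt0.
- exact: measurable_phi.
- exact: c0.
- by rewrite [RHS]EFinM (EFin_besselH z0 pz).
exact: measurableT.
Qed.

(** For fixed [u] the integral in [t] is Gaussian and equals [Num.sqrt pi * expR (u / 2)]; this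
    factor raises the index from [nu] to [nu + 1 / 2]. *)
Lemma integral_besselH_sqr (R : realType) (nu : R) : - (1 / 2) < nu ->
  (\int[@lebesgue_measure R]_(t in `]0%R, +oo[) (besselH nu (t ^+ 2 / 4))%:E =
   (Num.sqrt pi * besselH (nu + 1 / 2) 0)%:E)%E.
Proof.
move=> hnu; have gaussE := @integral_gauss_half R.
have s0 : 0 <= Num.sqrt pi :> R by exact: sqrtr_ge0.
(* From here on the constant is an abstract [s], known only to be nonnegative and to give the
   Gaussian integrals. *)
move: s0 gaussE; move: (Num.sqrt pi) => s s0 gaussE.
(* The indicator extends the integrand to the whole plane, so that Tonelli applies to two full
   lines. *)
pose f (w : R * R) : \bar R := (\1_`]0, +oo[%classic w.1 * phi nu (w.1 ^+ 2 / 4) w.2)%:E.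
have f0 w : (0 <= f w)%E by rewrite lee_fin mulr_ge0// ltW// phi_gt0.
have mf : measurable_fun setT f.
  apply/measurable_EFinP; apply: measurable_funM.
    apply: measurableT_comp; last exact: measurable_fst.
    exact: measurable_indic.
  apply: measurableT_comp; first exact: measurable_expR.
  apply: measurable_funB.
    apply: measurable_funB.
      by apply: measurable_funM; [exact: measurable_cst|exact: measurable_snd].
    by apply: measurableT_comp; [exact: measurable_expR|exact: measurable_snd].
  apply: measurable_funM.
    apply: measurable_funM; last exact: measurable_cst.
    by apply: (measurable_funX 2%N); exact: measurable_fst.
  apply: measurableT_comp; first exact: measurable_expR.
  by apply: measurableT_comp; [exact: oppr_measurable|exact: measurable_snd].
have FT := @fubini_tonelli _ _ _ _ _ (@lebesgue_measure R) (@lebesgue_measure R) f mf f0.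
transitivity (\int[@lebesgue_measure R]_t \int[@lebesgue_measure R]_u f (t, u))%E.
  rewrite integral_mkcond; apply: eq_integral => t _; rewrite patchE /f /= indicE.
  case: ifPn => t0.
    have {}t0 : 0 < t ^+ 2 / 4.
      by apply: sqr_quarter_gt0; move: t0; rewrite inE/= in_itv/= andbT.
    rewrite EFin_besselH; [|exact: ltW|by right].
    by apply: eq_integral => u _; rewrite mul1r.
  by under eq_integral do rewrite mul0r; rewrite integral0.
rewrite FT.
transitivity (\int[@lebesgue_measure R]_u (s * phi (nu + 1 / 2) 0 u)%:E)%E; last first.
  have p0 : 0 < nu + 1 / 2 by lra.
  exact: EFinM_besselH s0 (lexx 0) (or_introl p0).
apply: eq_integral => u _.
(* The scale for which [(a * t) ^+ 2] is [(t ^+ 2 / 4) * expR (- u)]. *)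
set a := expR (- (u / 2)) / 2.
have a0 : 0 < a by rewrite divr_gt0 ?expR_gt0.
have phi0 : 0 <= phi (nu + 1 / 2) 0 u by rewrite ltW ?phi_gt0.
have fE t : phi nu (t ^+ 2 / 4) u = 2 * phi (nu + 1 / 2) 0 u * (gauss_fun (a * t) * a).
  have e2 : expR (- (u / 2)) ^+ 2 = expR (- u).
    by rewrite -expRM_natl; congr expR; field.
  rewrite (_ : 2 * _ * _ = phi (nu + 1 / 2) 0 u * expR (- (u / 2)) * gauss_fun (a * t)).
    by rewrite /gauss_fun /phi exprMn /a expr_div_n e2 -!expRD; congr expR; field.
  by rewrite /a; field.
rewrite /f /=.
transitivity (\int[@lebesgue_measure R]_(t in `]0%R, +oo[)
    ((2 * phi (nu + 1 / 2) 0 u)%:E * (gauss_fun (a * t) * a)%:E))%E.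
  rewrite [RHS]integral_mkcond; apply: eq_integral => t _; rewrite patchE indicE.
  case: ifPn => _; last by rewrite mul0r.
  by rewrite -EFinM [X in X%:E]mul1r (fE t).
rewrite integral_itv_obnd_cbnd; last first.
  apply: measurable_funTS; apply: measurable_funeM; apply/measurable_EFinP.
  apply: measurable_funM; last exact: measurable_cst.
  apply: measurableT_comp; first exact: measurable_gauss_fun.
  by apply: measurable_funM; [exact: measurable_cst|exact: measurable_id].
rewrite ge0_integralZl_EFin; last 3 first.
- by move=> t _; rewrite lee_fin mulr_ge0 ?gauss_fun_ge0 ?ltW.
- apply/measurable_EFinP/measurable_funTS.
  apply: measurable_funM; last exact: measurable_cst.
  apply: measurableT_comp; first exact: measurable_gauss_fun.
  by apply: measurable_funM; [exact: measurable_cst|exact: measurable_id].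
- by rewrite mulr_ge0.
- by rewrite gaussE -?EFinM; [congr EFin; field|].
exact: measurable_itv.
Qed.

(** * The power series [besselG] *)

Lemma Gamma_gt0 (R : realType) (p : R) : 0 < p -> 0 < Gamma p.
Proof. by move=> p0; rewrite Gamma_besselH besselH_gt0//; left. Qed.

Lemma GammaS (R : realType) (p : R) : 0 < p -> Gamma (p + 1) = p * Gamma p.
Proof.
by move=> p0; rewrite !Gamma_besselH besselH_rec//; [rewrite mul0r add0r|left].
Qed.

Definition besselG_coef (R : realType) (nu : R) (k : nat) : R :=
  (k`!%:R * Gamma (nu + k%:R + 1))^-1.

Definition besselG (R : realType) (nu z : R) : R :=
  limn (pseries (besselG_coef nu) z).

Lemma besselG_coef_gt0 (R : realType) (nu : R) k : -1 < nu -> 0 < besselG_coef nu k.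
Proof.
move=> nu1; rewrite invr_gt0 mulr_gt0 ?ltr0n ?fact_gt0// Gamma_gt0//.
have := ler0n R k; lra.
Qed.

(** Comparison with the exponential series. Passing from [k] to [k + 1] divides the reciprocal gamma
    factor by [nu + k + 1], which exceeds 1 once [k >= 1]. The first step may increase it if
    [nu < 0], so the constant is [M 0 + M 1]. *)
Lemma besselG_coef_le (R : realType) (nu : R) : -1 < nu ->
  exists2 M, 0 <= M & forall k, besselG_coef nu k <= M / k`!%:R.
Proof.
move=> nu1; pose M k : R := (Gamma (nu + k%:R + 1))^-1.
have M0 k : 0 < M k.
  by rewrite invr_gt0 Gamma_gt0//; have := ler0n R k; lra.
have MS k : M k.+2 <= M k.+1.
  rewrite /M -(natr1 k.+1) addrA GammaS; last by have := ler0n R k.+1; lra.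
  have k0 := ler0n R k; have M1 := M0 k.+1.
  rewrite invfM ler_piMl ?(ltW M1)// invf_le1 -natr1; lra.
have Mle k : M k <= M 0%N + M 1%N.
  have M1 n : M n.+1 <= M 1%N by elim: n => [|n]; [exact: lexx|exact: le_trans (MS n)].
  case: k => [|k]; first by rewrite lerDl ltW.
  by rewrite (le_trans (M1 k))// lerDr ltW.
exists (M 0%N + M 1%N); first by rewrite addr_ge0 ?ltW.
move=> k; rewrite /besselG_coef invfM mulrC; apply: ler_wpM2r; last exact: Mle.
by rewrite invr_ge0 ler0n.
Qed.

Lemma is_cvg_besselG (R : realType) (nu z : R) : -1 < nu ->
  cvgn (pseries (besselG_coef nu) z).
Proof.
move=> nu1; have [M M0 cM] := besselG_coef_le nu1.
apply: normed_cvg; apply: (@series_le_cvg _ _ (fun k => M *: exp_coeff `|z| k)).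
- by move=> k; exact: normr_ge0.
- move=> k; rewrite /exp_coeff /= /GRing.scale /= mulr_ge0//.
- move=> k; rewrite /= normrM normrX ger0_norm; last exact/ltW/besselG_coef_gt0.
  rewrite /exp_coeff /GRing.scale/= mulrCA [leRHS]mulrC.
  by apply: ler_wpM2r; [rewrite exprn_ge0|exact: cM].
- by apply: is_cvg_seriesZ; exact: is_cvg_series_exp_coeff.
Qed.

Lemma pseries_diffs_besselG (R : realType) (nu : R) :
  pseries_diffs (besselG_coef nu) = besselG_coef (nu + 1).
Proof.
apply/funext => k; rewrite /pseries_diffs /besselG_coef factS natrM -mulrA invfM mulrA.
rewrite divff; last by rewrite pnatr_eq0.
rewrite mul1r; congr (_ * Gamma _)^-1.
by rewrite -natr1; ring.
Qed.

Lemma is_derive_besselG (R : realType) (nu z : R) : -1 < nu ->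
  is_derive z 1 (besselG nu) (besselG (nu + 1) z).
Proof.
move=> nu1; rewrite /besselG -pseries_diffs_besselG.
apply: (@pseries_snd_diffs _ _ (`|z| + 1)).
- exact: is_cvg_besselG.
- by rewrite pseries_diffs_besselG; apply: is_cvg_besselG; lra.
- by rewrite !pseries_diffs_besselG; apply: is_cvg_besselG; lra.
- by rewrite [ltRHS]ger0_norm ?addr_ge0// ltrDl.
Qed.

(** By the functional equation of [Gamma], the coefficient of index [k] for [nu] is [k + (nu + 1)]
    times that for [nu + 1]; the summand [k] yields [z] times the derivative of
    [besselG (nu + 1)]. *)
Lemma besselG_rec (R : realType) (nu z : R) : -1 < nu ->
  z * besselG (nu + 2) z + (nu + 1) * besselG (nu + 1) z = besselG nu z.
Proof.
move=> nu1; have nu2 : nu + 2 = nu + 1 + 1 by ring.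
have c1 : cvgn (pseries (besselG_coef (nu + 1)) z) by apply: is_cvg_besselG; lra.
have c2 : cvgn (pseries (pseries_diffs (besselG_coef (nu + 1))) z).
  by rewrite pseries_diffs_besselG; apply: is_cvg_besselG; lra.
(* The derivative series is taken in its unshifted form, with [z ^+ i.-1], so that multiplying by
   [z] matches the partial sums term by term. *)
have := pseries_diffs_equiv c2; rewrite pseries_diffs_besselG -nu2 => c3.
apply/esym/cvg_lim => //.
have c4 : (fun n => z * series (fun i => i%:R * besselG_coef (nu + 1) i * z ^+ i.-1) n
    + (nu + 1) * pseries (besselG_coef (nu + 1)) z n) @ \oo -->
    z * besselG (nu + 2) z + (nu + 1) * besselG (nu + 1) z.
  by apply: cvgD; [exact: cvgM (cvg_cst z) c3|exact: cvgM (cvg_cst (nu + 1)) c1].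
apply: cvg_trans c4; apply: near_eq_cvg; apply: nearW => n.
rewrite /pseries /series /= !mulr_sumr -big_split/=; apply: eq_bigr => i _.
have -> : besselG_coef nu i = (i%:R + (nu + 1)) * besselG_coef (nu + 1) i.
  have i0 := ler0n R i; have p0 : 0 < nu + i%:R + 1 by lra.
  rewrite /besselG_coef (_ : nu + 1 + i%:R + 1 = nu + i%:R + 1 + 1); last by ring.
  rewrite (GammaS p0); have := Gamma_gt0 p0.
  move: (Gamma _) => G G0; field.
  by rewrite pnatr_eq0 -lt0n fact_gt0 !gt_eqF//; lra.
by case: i => [|i]; rewrite ?exprS /=; ring.
Qed.

Lemma besselG_gt0 (R : realType) (nu z : R) : -1 < nu -> 0 <= z -> 0 < besselG nu z.
Proof.
move=> nu1 z0.
apply: (@lt_le_trans _ _ (pseries (besselG_coef nu) z 1%N)).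
  by rewrite /pseries/series/= big_nat1 expr0 mulr1 besselG_coef_gt0.
apply: nondecreasing_cvgn_le; last exact: is_cvg_besselG.
apply: nondecreasing_series => k _ _.
by rewrite mulr_ge0 ?exprn_ge0// ltW// besselG_coef_gt0.
Qed.

Lemma besselG0 (R : realType) (nu : R) : -1 < nu -> besselG nu 0 = (Gamma (nu + 1))^-1.
Proof.
move=> nu1; apply/cvg_lim => //; apply: cvg_near_cst; near=> n.
have n0 : (0 < n)%N by near: n; exact: nbhs_infty_gt.
rewrite /pseries/series/= -(prednK n0) big_nat_recl// big1_seq ?addr0.
  by rewrite expr0 mulr1 /besselG_coef fact0 mul1r addr0.
by move=> i _; rewrite expr0n mulr0.
Unshelve. all: by end_near. Qed.

Lemma besselI_besselG (R : realType) (nu x : R) : -1 < nu -> 0 < x ->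
  besselI nu x = (x / 2) `^ nu * besselG nu (x ^+ 2 / 4).
Proof.
move=> nu1 x0; rewrite /besselI /besselG.
have cG := is_cvg_besselG (z := x ^+ 2 / 4) nu1.
apply/cvg_lim => //.
have c : (x / 2) `^ nu * pseries (besselG_coef nu) (x ^+ 2 / 4) n @[n --> \oo] -->
    (x / 2) `^ nu * limn (pseries (besselG_coef nu) (x ^+ 2 / 4)).
  exact: cvgM (cvg_cst _) cG.
apply: cvg_trans c; apply: near_eq_cvg; apply: nearW => n.
rewrite /pseries /series /= mulr_sumr; apply: eq_bigr => k _.
have x20 : 0 < x / 2 by lra.
rewrite powRD; last by rewrite (gt_eqF x20) implybT.
rewrite powR_mulrn ?ltW// -muln2 mulnC exprM -mulrA mulrA /besselG_coef.
rewrite (_ : (x / 2) ^+ 2 = x ^+ 2 / 4); last by field.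
by rewrite -mulrA; congr (_ * _); rewrite mulrC.
Qed.

(** * Monotonicity and bounds on ratios of consecutive orders *)

Lemma nondecreasing_derive_gt0 (R : realType) (f df : R -> R) :
  (forall x : R, 0 < x -> is_derive x 1 f (df x)) ->
  (forall x : R, 0 < x -> 0 <= df x) ->
  forall x y : R, 0 < x -> x <= y -> f x <= f y.
Proof.
move=> fdf df0 x y x0; apply: (@ger0_derive1_ndecry _ f x) => //.
- move=> t; rewrite in_itv/= andbT => xt.
  by have ? := fdf _ (lt_trans x0 xt); exact: ex_derive.
- move=> t; rewrite in_itv/= andbT => xt; have t0 := lt_trans x0 xt.
  by rewrite derive1E (@derive_val _ _ _ _ _ _ _ (fdf _ t0)) df0.
- apply: continuous_in_subspaceT => t; rewrite inE/= in_itv/= andbT => xt.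
  exact: is_derive_continuous (fdf _ (lt_le_trans x0 xt)).
Qed.

Lemma nonincreasing_derive_le0 (R : realType) (f df : R -> R) :
  (forall x : R, 0 < x -> is_derive x 1 f (df x)) ->
  (forall x : R, 0 < x -> df x <= 0) ->
  forall x y : R, 0 < x -> x <= y -> f y <= f x.
Proof.
move=> fdf df0 x y x0 xy; rewrite -lerN2.
apply: (@nondecreasing_derive_gt0 _ (fun x => - f x) (fun x => - df x)) => //.
- by move=> t t0; have := fdf _ t0 => ?; exact: is_deriveN.
- by move=> t t0; rewrite oppr_ge0 df0.
Qed.

Lemma powR_pred (R : realType) (z a : R) : 0 < z -> z `^ a = z * z `^ (a - 1).
Proof.
move=> z0; rewrite -[in LHS](subrK 1 a) (@powRD _ z (a - 1) 1); last by rewrite (gt_eqF z0) implybT.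
by rewrite powRr1 ?(ltW z0)// mulrC.
Qed.

(* Equivalent to [I_(nu+1)(x) / I_nu(x) <= x / (nu + 1/2 + sqrt (x^2 + (nu + 1/2)^2))]. *)
Lemma besselG_amos (R : realType) (nu z : R) : - (1 / 2) < nu -> 0 < z ->
  0 <= besselG nu z ^+ 2 - z * besselG (nu + 1) z ^+ 2
       - (nu + 1 / 2) * (besselG nu z * besselG (nu + 1) z).
Proof.
move=> hnu z0; set a := nu + 1 / 2; have a0 : 0 < a by rewrite /a; lra.
have nu1 : -1 < nu by lra.
have D0 (t : R) : is_derive t 1 (besselG nu) (besselG (nu + 1) t).
  exact: is_derive_besselG.
have D1 (t : R) : is_derive t 1 (besselG (nu + 1)) (besselG (nu + 2) t).
  by rewrite (_ : nu + 2 = nu + 1 + 1); [apply: is_derive_besselG; lra|ring].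
have rec (t : R) := besselG_rec t nu1.
have p0 (t : R) : 0 < t -> 0 < besselG nu t.
  by move=> t0; exact: besselG_gt0 nu1 (ltW t0).
have p1 (t : R) : 0 < t -> 0 < besselG (nu + 1) t.
  by move=> t0; apply: besselG_gt0 (ltW t0); lra.
move: D0 D1 rec p0 p1; move: (besselG nu) (besselG (nu + 1)) (besselG (nu + 2)).
move=> G0 G1 G2 D0 D1 rec p0 p1.
pose f z := G0 z ^+ 2 - z * G1 z ^+ 2 - a * (G0 z * G1 z).
pose df z := a * (G1 z ^+ 2 - G0 z * G2 z).
have Df (t : R) : is_derive t 1 f (df t).
  by apply: is_derive_eq; rewrite /GRing.scale /= /df -(rec t) /a; field.
(* The weight makes the sign of the derivative visible: after [z * G2 = G0 - (nu + 1) * G1], all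
   quadratic terms cancel except [(nu + 1 - a) * G0 * G1], and [nu + 1 - a = 1 / 2]. *)
pose P z := z `^ a * f z.
pose dP z := z `^ (a - 1) * (a / 2 * (G0 z * G1 z)).
have DP (t : R) : 0 < t -> is_derive t 1 P (dP t).
  move=> t0; have Dw := is_derive1_powR a t0.
  apply: is_derive_eq; rewrite /GRing.scale /= (powR_pred a t0) /dP /df /f.
  by rewrite -(rec t) /a; field.
have dP0 t : 0 < t -> 0 <= dP t.
  move=> t0; rewrite /dP mulr_ge0 ?powR_ge0// mulr_ge0//; first by lra.
  by rewrite mulr_ge0// ltW ?p0 ?p1.
have limP : P t @[t --> 0^'+] --> 0.
  rewrite -[X in _ --> X](mul0r (f 0)); apply: cvgM; first exact: powR_cvg0.
  by apply: cvg_at_right_filter; exact: is_derive_continuous (Df 0).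
(* [P] is nondecreasing and tends to 0 at 0, since [a > 0]. *)
have P0 : 0 <= P z.
  apply: (cvgr_to_le limP); near=> t; apply: (nondecreasing_derive_gt0 DP dP0).
    by near: t; exact: nbhs_right_gt.
  by near: t; exact: nbhs_right_le.
by move: P0; rewrite /P pmulr_rge0 ?powR_gt0.
Unshelve. all: by end_near. Qed.
Lemma cvgy_inv (R : realType) : x^-1 @[x --> +oo] --> (0 : R).
Proof.
by apply/gtr0_cvgV0; [near=> x; near: x; exact: nbhs_pinfty_gt|exact: cvg_id].
Unshelve. all: by end_near. Qed.

(* Equivalent to [K_nu(x) / K_(nu+1)(x) >= x / (nu + 1/2 + sqrt (x^2 + (nu + 1/2)^2))]. *)
Lemma besselH_segura (R : realType) (nu z : R) : - (1 / 2) < nu -> 0 < z ->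
  0 <= z * besselH nu z ^+ 2 + (nu + 1 / 2) * (besselH nu z * besselH (nu + 1) z)
       - besselH (nu + 1) z ^+ 2.
Proof.
move=> hnu z0; set a := nu + 1 / 2; have a0 : 0 < a by rewrite /a; lra.
set C := besselH (nu + 1 + 2) 0.
have D0 (t : R) : 0 < t -> is_derive t 1 (besselH nu) (- besselH (nu - 1) t).
  exact: is_derive_besselH.
have D1 (t : R) : 0 < t -> is_derive t 1 (besselH (nu + 1)) (- besselH nu t).
  by move=> t0; rewrite -[in X in - X](addrK 1 nu); exact: is_derive_besselH.
have rec (t : R) : 0 < t ->
    besselH (nu + 1) t = t * besselH (nu - 1) t + nu * besselH nu t.
  by move=> t0; exact: besselH_rec (ltW t0) (or_intror t0).
have p0 (t : R) : 0 < t -> 0 < besselH nu t.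
  by move=> t0; exact: besselH_gt0 (ltW t0) (or_intror t0).
have p1 (t : R) : 0 < t -> 0 < besselH (nu + 1) t.
  by move=> t0; exact: besselH_gt0 (ltW t0) (or_intror t0).
have u1 (t : R) : 0 < t -> besselH (nu + 1) t <= C / t.
  by apply: besselH_le; lra.
move: D0 D1 rec p0 p1 u1; move: (besselH nu) (besselH (nu + 1)) (besselH (nu - 1)) C.
move=> H0 H1 Hm C D0 D1 rec p0 p1 u1.
pose f z := z * H0 z ^+ 2 + a * (H0 z * H1 z) - H1 z ^+ 2.
(* The opposite weight leaves a multiple of [H0 * H1] with a negative coefficient, so [P] decreases
   and its sign is read off at infinity. *)
pose P z := z `^ (- a) * f z.
pose dP z := z `^ (- a - 1) * (- (a / 2) * (H0 z * H1 z)).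
have DP (t : R) : 0 < t -> is_derive t 1 P (dP t).
  move=> t0; have Dw := is_derive1_powR (- a) t0.
  have d0 := D0 _ t0; have d1 := D1 _ t0.
  apply: is_derive_eq; rewrite /GRing.scale /= (powR_pred (- a) t0) /dP /f.
  by rewrite (rec _ t0) /a; field.
have dP0 (t : R) : 0 < t -> dP t <= 0.
  move=> t0; rewrite /dP mulr_ge0_le0 ?powR_ge0// mulNr oppr_le0 mulr_ge0//; first by lra.
  by rewrite mulr_ge0// ltW ?p0 ?p1.
(* A lower bound for [P] at large [t]: only the term [- H1 ^+ 2] of [f] is negative, the weight is
   at most 1, and [H1 t <= C / t]. *)
have limP : - (C ^+ 2 * t^-1) @[t --> +oo] --> 0.
  rewrite -[X in _ --> X]oppr0 -[X in _ --> - X](mulr0 (C ^+ 2)).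
  apply: cvgN; apply: cvgM; first exact: cvg_cst.
  exact: cvgy_inv.
have P0 : 0 <= P z.
  apply: (cvgr_to_le limP); near=> t.
  have t1 : 1 <= t by near: t; exact: nbhs_pinfty_ge.
  have t0 : 0 < t by lra.
  apply: (@le_trans _ _ (P t)); last first.
    apply: (nonincreasing_derive_le0 DP dP0 z0).
    by near: t; apply: nbhs_pinfty_ge; exact: num_real.
  have w1 : t `^ (- a) <= 1.
    by rewrite -(powRr0 t) ler_powR//; lra.
  have w0 : 0 <= t `^ (- a) by exact: powR_ge0.
  have h1 := p1 _ t0; have h0 := p0 _ t0; have b1 := u1 _ t0.
  have s0 : 0 < t^-1 by rewrite invr_gt0.
  have s1 : t^-1 <= 1 by rewrite invf_le1.
  have b2 : H1 t ^+ 2 <= C ^+ 2 * t^-1.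
    apply: (@le_trans _ _ ((C / t) ^+ 2)).
      by rewrite lerXn2r// nnegrE ltW// (lt_le_trans h1).
    by rewrite exprMn ler_wpM2l ?sqr_ge0// expr2 ler_piMl// ltW.
  have b3 : t `^ (- a) * H1 t ^+ 2 <= H1 t ^+ 2 by rewrite ler_piMl ?sqr_ge0.
  have b4 : 0 <= t `^ (- a) * (t * H0 t ^+ 2 + a * (H0 t * H1 t)).
    rewrite mulr_ge0// addr_ge0// mulr_ge0 ?sqr_ge0 ?(ltW t0) ?(ltW a0)//.
    by rewrite mulr_ge0// ltW.
  rewrite /P /f mulrBr; lra.
by move: P0; rewrite /P pmulr_rge0 ?powR_gt0.
Unshelve. all: by end_near. Qed.

(** * Products of [besselG] and [besselH] *)

(* The Amos and Segura bounds have the same right-hand side. *)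
Lemma besselGH_nincr (R : realType) (nu z : R) : - (1 / 2) < nu -> 0 < z ->
  besselG (nu + 1) z * besselH (nu + 1) z <= besselG nu z * besselH nu z.
Proof.
move=> hnu z0; have := besselG_amos hnu z0; have := besselH_segura hnu z0.
have : 0 < besselG nu z by apply: besselG_gt0 (ltW z0); lra.
have : 0 < besselG (nu + 1) z by apply: besselG_gt0 (ltW z0); lra.
have : 0 < besselH nu z by exact: besselH_gt0 (ltW z0) (or_intror z0).
have : 0 < besselH (nu + 1) z by exact: besselH_gt0 (ltW z0) (or_intror z0).
have : 0 < nu + 1 / 2 by lra.
move: (nu + 1 / 2) (besselG nu z) (besselG (nu + 1) z) (besselH nu z) (besselH (nu + 1) z).
move=> a g0 g1 h0 h1 a0 h1_gt0 h0_gt0 g1_gt0 g0_gt0 Hle Gle.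
rewrite leNgt; apply/negP => lt.
have q : 0 < g1 * h1 + g0 * h0 by rewrite addr_gt0// mulr_gt0.
(* The left-hand sides of [e2] and [e3] below add up to minus this product, which eliminates the
   common square root without ever introducing it. *)
have e1 : 0 < (g1 * h1 - g0 * h0) * (z * (g1 * h1 + g0 * h0) + a * (g0 * h1)).
  by rewrite mulr_gt0 ?subr_gt0// addr_gt0// !mulr_gt0.
have e2 : 0 <= h1 ^+ 2 * (g0 ^+ 2 - z * g1 ^+ 2 - a * (g0 * g1)).
  by rewrite mulr_ge0// sqr_ge0.
have e3 : 0 <= g0 ^+ 2 * (z * h0 ^+ 2 + a * (h0 * h1) - h1 ^+ 2).
  by rewrite mulr_ge0// sqr_ge0.
nra.
Qed.

(** The two recurrences make the derivative of the left-hand side vanish. Near 0, [besselH] is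
    bounded by its value at 0, so an inequality is obtained from the continuity of [besselG] alone;
    the limit is [Gamma (mu + 1)] times its inverse. *)
Lemma wronskian_le1 (R : realType) (mu z : R) : 0 < mu -> 0 < z ->
  besselG mu z * besselH (mu + 1) z + z * besselG (mu + 1) z * besselH mu z <= 1.
Proof.
move=> mu0 z0; have mu1 : -1 < mu by lra.
have mu11 : -1 < mu + 1 by lra.
have mu10 : 0 < mu + 1 by lra.
have D0 (t : R) : is_derive t 1 (besselG mu) (besselG (mu + 1) t).
  exact: is_derive_besselG.
have D1 (t : R) : is_derive t 1 (besselG (mu + 1)) (besselG (mu + 2) t).
  by rewrite (_ : mu + 2 = mu + 1 + 1); [exact: is_derive_besselG|ring].
have E0 (t : R) : 0 < t -> is_derive t 1 (besselH mu) (- besselH (mu - 1) t).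
  exact: is_derive_besselH.
have E1 (t : R) : 0 < t -> is_derive t 1 (besselH (mu + 1)) (- besselH mu t).
  by move=> t0; rewrite -[in X in - X](addrK 1 mu); exact: is_derive_besselH.
have recG (t : R) := besselG_rec t mu1.
have recH (t : R) : 0 < t ->
    besselH (mu + 1) t = t * besselH (mu - 1) t + mu * besselH mu t.
  by move=> t0; exact: besselH_rec (ltW t0) (or_intror t0).
have p0 (t : R) : 0 < t -> 0 < besselG mu t.
  by move=> t0; exact: besselG_gt0 (ltW t0).
have p1 (t : R) : 0 < t -> 0 < besselG (mu + 1) t.
  by move=> t0; exact: besselG_gt0 (ltW t0).
have u0 (t : R) : 0 < t -> besselH mu t <= besselH mu 0.
  by move=> t0; exact: besselH_le0 (ltW t0) mu0.
have u1 (t : R) : 0 < t -> besselH (mu + 1) t <= besselH (mu + 1) 0.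
  by move=> t0; exact: besselH_le0 (ltW t0) mu10.
have G0H : besselG mu 0 * besselH (mu + 1) 0 = 1.
  by rewrite besselG0// Gamma_besselH mulVf// gt_eqF// besselH_gt0//; left.
move: D0 D1 E0 E1 recG recH p0 p1 u0 u1 G0H.
move: (besselG mu) (besselG (mu + 1)) (besselG (mu + 2)) => G0 G1 G2.
move: (besselH mu) (besselH (mu + 1)) (besselH (mu - 1)) => H0 H1 Hm.
move=> D0 D1 E0 E1 recG recH p0 p1 u0 u1 G0H.
pose W t := G0 t * H1 t + t * G1 t * H0 t.
have DW (t : R) : 0 < t -> is_derive t 1 W 0.
  move=> t0; have d0 := E0 _ t0; have d1 := E1 _ t0.
  apply: is_derive_eq; rewrite /GRing.scale /= (recH _ t0) -(recG t).
  by field.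
have lim : G0 t * H1 0 + t * G1 t * H0 0 @[t --> 0^'+] --> (1 : R).
  have -> : 1 = G0 0 * H1 0 + 0 * G1 0 * H0 0 by rewrite mul0r mul0r addr0 G0H.
  apply: cvg_at_right_filter.
  apply: (@is_derive_continuous _ (fun t => G0 t * H1 0 + t * G1 t * H0 0)).
apply: (cvgr_to_ge lim); near=> t.
have t0 : 0 < t by near: t; exact: nbhs_right_gt.
have tz : t <= z by near: t; exact: nbhs_right_le.
apply: (le_trans (nonincreasing_derive_le0 DW (fun _ _ => lexx 0) t0 tz)).
rewrite /W lerD// ler_wpM2l ?u0 ?u1 ?mulr_ge0 ?(ltW t0)//; last exact/ltW/p1.
exact/ltW/p0.
Unshelve. all: by end_near. Qed.

(** Expanding [besselH (mu + 1)] by its recurrence in the Wronskian bound gives [mu] times the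
    product plus two strictly positive terms. *)
Lemma besselGH_lt (R : realType) (mu z : R) : 0 < mu -> 0 < z ->
  besselG mu z * besselH mu z < mu^-1.
Proof.
move=> mu0 z0; have := wronskian_le1 mu0 z0.
rewrite besselH_rec ?(ltW z0)//; last by right.
have g0 : 0 < besselG mu z by apply: besselG_gt0 (ltW z0); lra.
have g1 : 0 < besselG (mu + 1) z by apply: besselG_gt0 (ltW z0); lra.
have h0 : 0 < besselH mu z by exact: besselH_gt0 (ltW z0) (or_intror z0).
have hm : 0 < besselH (mu - 1) z by exact: besselH_gt0 (ltW z0) (or_intror z0).
have q1 := mulr_gt0 (mulr_gt0 z0 g1) h0.
have q2 := mulr_gt0 (mulr_gt0 z0 hm) g0.
rewrite -[X in _ -> _ < X]div1r ltr_pdivlMr//.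
move: q1 q2; clear g0 g1 h0 hm; move: (besselG mu z) (besselG (mu + 1) z) (besselH mu z).
by move: (besselH (mu - 1) z) => ? ? ? ?; lra.
Qed.

(** * The tail integral of [besselH] *)

(** The function [tau] of the introductory sketch. *)
Definition besselH_tail (R : realType) (nu x : R) : R :=
  Rintegral (@lebesgue_measure R) `[x, +oo[ (fun t => besselH nu (t ^+ 2 / 4)).

Lemma integrable_besselH_sqr (R : realType) (nu : R) : - (1 / 2) < nu ->
  (@lebesgue_measure R).-integrable (`[0, +oo[%classic : set R)
    (EFin \o (fun t => besselH nu (t ^+ 2 / 4))).
Proof.
move=> hnu; have mH := measurable_besselH_sqr nu.
apply/integrableP; split.
  exact/measurable_EFinP/measurable_fun_itv_obnd_cbndP.
(* For [nu <= 0] the integral [besselH nu 0] diverges and takes the default value 0; the endpoint is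
   discarded as a null set. *)
rewrite -integral_itv_obnd_cbnd; last first.
  by apply: measurableT_comp => //; exact/measurable_EFinP.
have -> : (\int[@lebesgue_measure R]_(t in `]0%R, +oo[)
    `|(EFin \o (fun t => besselH nu (t ^+ 2 / 4))) t| =
    (Num.sqrt pi * besselH (nu + 1 / 2) 0)%:E)%E.
  rewrite -integral_besselH_sqr//; apply: eq_integral => t.
  rewrite inE/= in_itv/= andbT => t0; rewrite ger0_norm// ltW//.
  by apply: besselH_gt0; [exact/ltW/sqr_quarter_gt0|right; exact: sqr_quarter_gt0].
exact: ltry.
Qed.

Lemma integrable_besselH_sqrS (R : realType) (nu : R) (D : set R) : - (1 / 2) < nu ->
  measurable D -> D `<=` `[0, +oo[%classic ->
  (@lebesgue_measure R).-integrable D (EFin \o (fun t => besselH nu (t ^+ 2 / 4))).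
Proof.
move=> hnu mD D0; apply: integrableS (integrable_besselH_sqr hnu) => //.
Qed.

Lemma besselH_tail0 (R : realType) (nu : R) : - (1 / 2) < nu ->
  besselH_tail nu 0 = Num.sqrt pi * besselH (nu + 1 / 2) 0.
Proof.
move=> hnu; rewrite /besselH_tail /Rintegral -integral_itv_obnd_cbnd; last first.
  by apply/measurable_EFinP; exact: measurable_besselH_sqr.
by rewrite integral_besselH_sqr.
Qed.

(** Rewrites the tail through a primitive based at 0, to which the fundamental theorem and
    continuity at the left endpoint apply. *)
Lemma besselH_tailE (R : realType) (nu x : R) : - (1 / 2) < nu -> 0 <= x ->
  besselH_tail nu x = besselH_tail nu 0
    - parameterized_integral (@lebesgue_measure R) 0 x (fun t => besselH nu (t ^+ 2 / 4)).
Proof.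
move=> hnu x0; rewrite /besselH_tail /parameterized_integral.
rewrite (@Rintegral_itvB _ _ (BLeft 0) +oo%O x)//; last exact: integrable_besselH_sqr.
rewrite Rintegral_itv_obnd_cbnd//; apply: integrable_besselH_sqrS => //.
by apply: subset_itvr; rewrite bnd_simp.
Qed.

Lemma is_derive_besselH_tail (R : realType) (nu x : R) : - (1 / 2) < nu -> 0 < x ->
  is_derive x 1 (besselH_tail nu) (- besselH nu (x ^+ 2 / 4)).
Proof.
move=> hnu x0; set F := fun x => besselH_tail nu 0
    - parameterized_integral (@lebesgue_measure R) 0 x (fun t => besselH nu (t ^+ 2 / 4)).
have x1 : x < x + 1 by lra.
have intf : (@lebesgue_measure R).-integrable (`[0, x + 1]%classic : set R)
    (EFin \o (fun t => besselH nu (t ^+ 2 / 4))).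
  by apply: integrable_besselH_sqrS => //; exact: subset_itvl.
have cf := is_derive_continuous (is_derive_besselH_sqr nu x0).
have [dI I'] := continuous_FTC1_closed x1 intf x0 cf.
have DI : is_derive x 1 (fun x => parameterized_integral (@lebesgue_measure R) 0 x
    (fun t => besselH nu (t ^+ 2 / 4))) (besselH nu (x ^+ 2 / 4)).
  by apply: DeriveDef; [exact: dI|rewrite -derive1E; exact: I'].
have DF : is_derive x 1 F (- besselH nu (x ^+ 2 / 4)).
  rewrite -[- _]sub0r; exact: (is_deriveB (is_derive_cst (besselH_tail nu 0) x 1) DI).
(* The two functions are only known to agree on nonnegative arguments, which include a neighbourhood
   of [x]. *)
apply: near_eq_is_derive DF; near=> y.
rewrite /F [RHS]besselH_tailE//; apply: ltW; near: y; exact: lt_nbhsr.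
Unshelve. all: by end_near. Qed.

Lemma cvg_besselH_tail (R : realType) (nu : R) : - (1 / 2) < nu ->
  besselH_tail nu x @[x --> 0^'+] --> Num.sqrt pi * besselH (nu + 1 / 2) 0.
Proof.
move=> hnu; rewrite -besselH_tail0//.
have intf : (@lebesgue_measure R).-integrable (`[0, 1]%classic : set R)
    (EFin \o (fun t => besselH nu (t ^+ 2 / 4))).
  by apply: integrable_besselH_sqrS => //; exact: subset_itvl.
have I0 := cvg_at_right_filter (parameterized_integral_cvg_left ltr01 intf).
rewrite -[X in _ --> X]subr0.
apply: cvg_trans (cvgB (cvg_cst (besselH_tail nu 0)) I0).
apply: near_eq_cvg; near=> x.
by rewrite /= [RHS]besselH_tailE.
Unshelve. all: by end_near. Qed.

Lemma EFin_besselH_tail (R : realType) (nu x : R) : - (1 / 2) < nu -> 0 <= x ->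
  (\int[@lebesgue_measure R]_(t in `[x, +oo[) (besselH nu (t ^+ 2 / 4))%:E =
   (besselH_tail nu x)%:E)%E.
Proof.
move=> hnu x0; rewrite /besselH_tail /Rintegral fineK//.
apply: integrable_fin_num => //.
apply: (integrable_besselH_sqrS hnu) => //.
by apply: subset_itvr; rewrite bnd_simp.
Qed.

Lemma besselH_tail_le (R : realType) (nu x : R) : - (1 / 2) < nu -> 0 < x ->
  besselH_tail nu x <= 2 / x * besselH (nu + 1) (x ^+ 2 / 4).
Proof.
move=> hnu x0; have x2 : 0 < 2 / x by rewrite divr_gt0.
rewrite -lee_fin -EFin_besselH_tail ?(ltW x0)//.
have gt0 t : x <= t -> 0 < t by exact: lt_le_trans.
have Hgt0 t : x <= t -> 0 < besselH nu (t ^+ 2 / 4).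
  move=> /gt0/sqr_quarter_gt0 t0; exact: besselH_gt0 (ltW t0) (or_intror t0).
pose f t := t / x * besselH nu (t ^+ 2 / 4).
(* An antiderivative of the majorant [f], because differentiating [besselH (nu + 1)] at [t ^+ 2 / 4]
   brings out the factor [- t / 2]. *)
pose F t := - (2 / x) * besselH (nu + 1) (t ^+ 2 / 4).
have DF (t : R) : 0 < t -> is_derive t 1 F (f t).
  move=> t0; have d := is_derive_besselH_sqr (nu + 1) t0.
  rewrite addrK in d.
  by apply: is_derive_eq; rewrite /GRing.scale /= /f; field; rewrite gt_eqF.
have cf (t : R) : x <= t -> {for t, continuous f}.
  move=> xt; apply: continuousM.
    by apply: is_derive_continuous.
  exact: is_derive_continuous (is_derive_besselH_sqr nu (gt0 _ xt)).
have F0 : F t @[t --> +oo] --> 0.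
  set C := besselH (nu + 1 + 2) 0.
  (* The constant is [2 / x] times the 4 from [C / (t ^+ 2 / 4)]; one of the two factors [t^-1] is
     dropped using [t >= 1]. *)
  have lim0 : 8 / x * C * t^-1 @[t --> +oo] --> 0.
    rewrite -[X in _ --> X](mulr0 (8 / x * C)); apply: cvgM; first exact: cvg_cst.
    exact: cvgy_inv.
  rewrite -[X in _ --> X]oppr0.
  rewrite (_ : F = fun t => - (2 / x * besselH (nu + 1) (t ^+ 2 / 4))); last first.
    by apply/funext => t; rewrite /F mulNr.
  apply: cvgN; apply: squeeze_cvgr (cvg_cst 0) lim0; near=> t.
  have t1 : 1 <= t by near: t; exact: nbhs_pinfty_ge.
  have t0 : 0 < t by lra.
  have q0 := sqr_quarter_gt0 t0.
  have h0 : 0 < besselH (nu + 1) (t ^+ 2 / 4).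
    exact: besselH_gt0 (ltW q0) (or_intror q0).
  rewrite mulr_ge0 ?(ltW x2) ?(ltW h0)//=.
  have nu1 : -1 < nu + 1 by lra.
  have C0 : 0 < C by apply: besselH_gt0 => //; left; lra.
  have tC : C / (t ^+ 2 / 4) <= 4 * C * t^-1.
    rewrite (_ : C / _ = 4 * C * t^-1 * t^-1); last by field; rewrite gt_eqF.
    by rewrite ler_piMr ?invf_le1// mulr_ge0 ?invr_ge0 ?(ltW t0)// mulr_ge0// ltW.
  rewrite (_ : 8 / x * C * t^-1 = 2 / x * (4 * C * t^-1)); last by ring.
  by rewrite ler_wpM2l ?(ltW x2)// (le_trans (besselH_le nu1 q0)).
have E : (\int[@lebesgue_measure R]_(t in `[x, +oo[) (f t)%:E = 0%:E - (F x)%:E)%E.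
  apply: ge0_continuous_FTC2y.
  - move=> t xt; rewrite /f mulr_ge0//; last exact/ltW/Hgt0.
    by rewrite divr_ge0 ?(ltW x0)// ltW// gt0.
  - apply: continuous_in_subspaceT => t; rewrite inE/= in_itv/= andbT; exact: cf.
  - exact: F0.
  - by move=> t xt; have ? := DF _ (lt_trans x0 xt); exact: ex_derive.
  - by apply: cvg_at_right_filter; exact: is_derive_continuous (DF _ x0).
  - move=> t; rewrite in_itv/= andbT => xt; have ? := DF _ (lt_trans x0 xt).
    by rewrite derive1E derive_val.
have -> : (2 / x * besselH (nu + 1) (x ^+ 2 / 4))%:E = (0%:E - (F x)%:E)%E.
  by rewrite -EFinB /F mulNr opprK add0r.
rewrite -E; apply: ge0_le_integral => //.
- by move=> t; rewrite /= in_itv/= andbT => xt; rewrite lee_fin ltW ?Hgt0.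
- apply/measurable_EFinP; apply: measurable_funS (measurable_besselH_sqr nu) => //.
  by move=> t; rewrite /= !in_itv/= !andbT; exact: gt0.
- apply/measurable_EFinP/measurable_fun_itv_obnd_cbndP.
  apply: open_continuous_measurable_fun; first exact: interval_open.
  by move=> t; rewrite inE/= in_itv/= andbT => xt; exact/cf/ltW.
- move=> t; rewrite /= in_itv/= andbT => xt; rewrite lee_fin /f ler_peMl ?(ltW (Hgt0 _ xt))//.
  by rewrite ler_pdivlMr// mul1r.
Unshelve. all: by end_near. Qed.

(** * Translation to [IK] and the two bounds *)

Lemma powR_half (R : realType) (nu x : R) : 0 < x ->
  x `^ nu = 2 `^ nu * (x / 2) `^ nu.
Proof.
move=> x0; rewrite -powRM//; last by rewrite divr_ge0// ltW.
by rewrite mulrC divfK.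
Qed.

(** In [t] to the power [nu] times [besselK nu t] the powers of [t / 2] cancel, leaving a constant
    multiple of [besselH nu (t ^+ 2 / 4)]. *)
Lemma tailKE (R : realType) (nu x : R) : - (1 / 2) < nu -> 0 < x ->
  tailK nu x = (2^-1 * 2 `^ nu * besselH_tail nu x)%:E.
Proof.
move=> hnu x0; have c0 : 0 <= 2^-1 * 2 `^ nu :> R by rewrite mulr_ge0 ?powR_ge0.
rewrite [RHS]EFinM -(EFin_besselH_tail hnu (ltW x0)) /tailK.
rewrite -ge0_integralZl_EFin; last 4 first.
- exact: measurable_itv.
- move=> t; rewrite /= in_itv/= andbT => xt.
  have q0 := sqr_quarter_gt0 (lt_le_trans x0 xt).
  by rewrite lee_fin; exact/ltW/(besselH_gt0 (ltW q0) (or_intror q0)).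
- apply/measurable_EFinP; apply: measurable_funS (measurable_besselH_sqr nu) => //.
  by move=> t; rewrite /= !in_itv/= !andbT; exact: lt_le_trans.
- exact: c0.
apply: eq_integral => t; rewrite inE/= in_itv/= andbT => xt.
have t0 := lt_le_trans x0 xt; have t20 : 0 < (t / 2) `^ nu by rewrite powR_gt0// divr_gt0.
rewrite -EFinM besselK_besselH// (powR_half nu t0) powRN; congr EFin.
by field; rewrite gt_eqF.
Qed.

Lemma IK_diag (R : realType) (nu x : R) : - (1 / 2) < nu -> 0 < x ->
  IK nu nu x = (2^-1 * besselG nu (x ^+ 2 / 4) * besselH_tail nu x)%:E.
Proof.
move=> hnu x0; rewrite /IK tailKE// -EFinM; congr EFin.
have t20 : 0 < (x / 2) `^ nu by rewrite powR_gt0// divr_gt0.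
have p20 : 0 < 2 `^ nu :> R by rewrite powR_gt0.
rewrite besselI_besselG//; last by lra.
rewrite (powR_half nu x0); move: (besselG _ _) (besselH_tail _ _) => g h.
by field; rewrite !gt_eqF.
Qed.

Lemma IK_succ (R : realType) (nu x : R) : - (1 / 2) < nu -> 0 < x ->
  IK (nu + 1) nu x =
  (x / 4 * besselG (nu + 1) (x ^+ 2 / 4) * besselH_tail nu x)%:E.
Proof.
move=> hnu x0; rewrite /IK tailKE// -EFinM; congr EFin.
have t20 : 0 < (x / 2) `^ nu by rewrite powR_gt0// divr_gt0.
have p20 : 0 < 2 `^ nu :> R by rewrite powR_gt0.
rewrite besselI_besselG//; last by lra.
rewrite (powR_half nu x0) powR_pred ?divr_gt0// addrK.
move: (besselG _ _) (besselH_tail _ _) => g h.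
by field; rewrite !gt_eqF.
Qed.

Lemma IK_succ_lt (R : realType) (nu x : R) : - (1 / 2) < nu -> 0 < x ->
  (IK (nu + 1) nu x < (1 / (2 * (nu + 1)))%:E)%E.
Proof.
move=> hnu x0; rewrite IK_succ// lte_fin.
have q0 := sqr_quarter_gt0 x0; have nu0 : 0 < nu + 1 by lra.
have g0 : 0 < besselG (nu + 1) (x ^+ 2 / 4) by apply: besselG_gt0 (ltW q0); lra.
have := besselGH_lt nu0 q0; have := besselH_tail_le hnu x0.
move: g0; move: (besselG _ _) (besselH_tail _ _) (besselH _ _) => g h H g0 hH gH.
(* The factor [x / 4] meets the [2 / x] of the tail bound. *)
apply: (@le_lt_trans _ _ (2^-1 * (g * H))).
  have := ler_wpM2l (ltW (mulr_gt0 (divr_gt0 x0 (ltr0n R 4)) g0)) hH.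
  move=> /le_trans; apply; rewrite le_eqVlt; apply/predU1l; field.
  by rewrite gt_eqF.
by rewrite div1r invfM ltr_pM2l.
Qed.

Lemma cvg_besselG_sqr (R : realType) (nu : R) : -1 < nu ->
  besselG nu (x ^+ 2 / 4) @[x --> 0^'+] --> (Gamma (nu + 1))^-1.
Proof.
move=> nu1; rewrite -besselG0//.
have -> : besselG nu 0 = besselG nu (0 ^+ 2 / 4) by rewrite expr0n mul0r.
apply: cvg_at_right_filter.
have dG := is_derive_besselG (0 ^+ 2 / 4) nu1.
apply: (@continuous_comp _ _ _ (fun x : R => x ^+ 2 / 4) (besselG nu)).
  exact: is_derive_continuous.
exact: is_derive_continuous dG.
Qed.

Lemma cvg_IK_diag (R : realType) (nu : R) : - (1 / 2) < nu ->
  IK nu nu x @[x --> 0^'+] -->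
    (Num.sqrt pi * Gamma (nu + 1 / 2) / (2 * Gamma (nu + 1)))%:E.
Proof.
move=> hnu; have nu1 : -1 < nu by lra.
have lim : 2^-1 * besselG nu (x ^+ 2 / 4) * besselH_tail nu x @[x --> 0^'+] -->
    Num.sqrt pi * Gamma (nu + 1 / 2) / (2 * Gamma (nu + 1)).
  have -> : Num.sqrt pi * Gamma (nu + 1 / 2) / (2 * Gamma (nu + 1)) =
      2^-1 * (Gamma (nu + 1))^-1 * (Num.sqrt pi * besselH (nu + 1 / 2) 0).
    by rewrite -Gamma_besselH invfM mulrC.
  apply: cvgM; last exact: cvg_besselH_tail.
  by apply: cvgM; [exact: cvg_cst|exact: cvg_besselG_sqr].
apply: cvg_EFin; first by near=> x; rewrite IK_diag.
by apply: cvg_trans lim; apply: near_eq_cvg; near=> x; rewrite /= IK_diag.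
Unshelve. all: by end_near. Qed.

Lemma IK_diag_le (R : realType) (nu x : R) : - (1 / 2) < nu -> 0 < x ->
  (IK nu nu x <= (Num.sqrt pi * Gamma (nu + 1 / 2) / (2 * Gamma (nu + 1)))%:E)%E.
Proof.
move=> hnu x0; have nu1 : -1 < nu by lra.
pose B (x : R) := 2^-1 * besselG nu (x ^+ 2 / 4) * besselH_tail nu x.
pose dB (x : R) := 2^-1 * (x / 2 * besselG (nu + 1) (x ^+ 2 / 4) * besselH_tail nu x
  - besselG nu (x ^+ 2 / 4) * besselH nu (x ^+ 2 / 4)).
have DB (t : R) : 0 < t -> is_derive t 1 B (dB t).
  move=> t0; have dT := is_derive_besselH_tail hnu t0.
  have dG := is_derive_besselG (t ^+ 2 / 4) nu1.
  have dq : is_derive t 1 (fun t => t ^+ 2 / 4) (t / 2).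
    by apply: is_derive_eq; rewrite /GRing.scale /=; field.
  have dGq := @is_derive1_comp R (besselG nu) (fun t => t ^+ 2 / 4) t _ _ dG dq.
  rewrite /B; apply: is_derive_eq; rewrite /GRing.scale /= /dB.
  move: (besselG nu _) (besselG (nu + 1) _) (besselH_tail _ _) (besselH _ _).
  by move=> g0 g1 T h; field.
have dB0 (t : R) : 0 < t -> dB t <= 0.
  move=> t0; rewrite /dB pmulr_rle0// subr_le0.
  have q0 := sqr_quarter_gt0 t0.
  (* It remains to bound the term with the tail by [besselG (nu + 1) * besselH (nu + 1)]; here
     [t / 2] cancels the [2 / t] of the tail bound. *)
  apply: le_trans (besselGH_nincr hnu q0).
  have g0 : 0 < besselG (nu + 1) (t ^+ 2 / 4) by apply: besselG_gt0 (ltW q0); lra.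
  have := besselH_tail_le hnu t0; move: g0.
  move: (besselG _ _) (besselH_tail _ _) (besselH _ _) => g h H g0 hH.
  have := ler_wpM2l (ltW (mulr_gt0 (divr_gt0 t0 (ltr0n R 2)) g0)) hH.
  move=> /le_trans; apply; rewrite le_eqVlt; apply/predU1l; field.
  by rewrite gt_eqF.
have E : \forall t \near 0^'+, (IK nu nu x <= IK nu nu t)%E.
  near=> t.
  rewrite (IK_diag hnu x0) IK_diag// lee_fin.
  apply: (nonincreasing_derive_le0 DB dB0); near: t; [exact: nbhs_right_gt|exact: nbhs_right_le].
exact: (cvge_to_ge (cvg_IK_diag hnu) E).
Unshelve. all: by end_near. Qed.

(** Compared with the diagonal case there is an extra factor [x], so the limit is 0; this is the
    value of [ext0] at 0 in the first bound. *)
Lemma cvg_IK_succ (R : realType) (nu : R) : - (1 / 2) < nu ->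
  IK (nu + 1) nu x @[x --> 0^'+] --> 0%:E.
Proof.
move=> hnu; have nu1 : -1 < nu + 1 by lra.
have limx : x / 4 @[x --> 0^'+] --> (0 : R).
  rewrite -[X in _ --> X](mul0r (4^-1 : R)).
  by apply: cvgM; [exact: cvg_at_right_filter cvg_id|exact: cvg_cst].
have lim : x / 4 * besselG (nu + 1) (x ^+ 2 / 4) * besselH_tail nu x @[x --> 0^'+] -->
    (0 : R).
  rewrite -[X in _ --> X](mul0r (Num.sqrt pi * besselH (nu + 1 / 2) 0)).
  apply: cvgM; last exact: cvg_besselH_tail.
  rewrite -[X in _ --> X](mul0r (Gamma (nu + 1 + 1))^-1).
  by apply: cvgM; [exact: limx|exact: cvg_besselG_sqr].
apply: cvg_EFin; first by near=> x; rewrite IK_succ.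
by apply: cvg_trans lim; apply: near_eq_cvg; near=> x; rewrite /= IK_succ.
Unshelve. all: by end_near. Qed.

Unset Implicit Arguments.

(** The first clause certifies that the value of [ext0 (IK (nu + 1) nu)] at 0 is a genuine limit;
    the last clause does the same for the diagonal expression. *)
Theorem theorem3p4 (R : realType) (nu : R) (hnu : - (1 / 2) < nu) :
  [/\ cvg (IK (nu + 1) nu x @[x --> 0^'+]),
      (forall x : R, 0 <= x ->
         (ext0 (IK (nu + 1) nu) x < (1 / (2 * (nu + 1)))%:E)%E),
      (forall x : R, 0 <= x ->
         (ext0 (IK nu nu) x
            <= (Num.sqrt pi * Gamma (nu + 1 / 2) / (2 * Gamma (nu + 1)))%:E)%E)
    & IK nu nu x @[x --> 0^'+] -->
        (Num.sqrt pi * Gamma (nu + 1 / 2) / (2 * Gamma (nu + 1)))%:E].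
Proof.
have lim0 := cvg_IK_succ hnu; have lim1 := cvg_IK_diag hnu.
split; [by apply/cvg_ex; eexists; exact: lim0| | |exact: lim1].
- move=> x; rewrite le_eqVlt /ext0 => /predU1P[<-|x0].
    rewrite eqxx (cvg_lim _ lim0)// lte_fin divr_gt0// mulr_gt0//; lra.
  by rewrite (gt_eqF x0); exact: IK_succ_lt.
- move=> x; rewrite le_eqVlt /ext0 => /predU1P[<-|x0].
    by rewrite eqxx (cvg_lim _ lim1).
  by rewrite (gt_eqF x0); exact: IK_diag_le.
Qed.
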